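(* Let $f:\mathbb{X}\times\Xi\to\mathbb{R}^M$ be a bounded objective function and let $\boldsymbol{\eta}\in\mathbb{R}^M$ be a reference vector. Then, for any partially coherent univariate risk functional $\rho$ and any subset of inputs $X\subseteq\mathbb{X}$, the STR front $$\mathcal{F}^{\mathrm{STR}}_{\boldsymbol{\eta},f,\rho}[X]:=\Bigl\{\boldsymbol{\eta}+\Bigl(\sup_{\mathbf{x}\in X}\rho\bigl[s^{\mathrm{Len}}_{(\boldsymbol{\eta},\boldsymbol{\lambda})}(f(\mathbf{x},\cdot))\bigr]\Bigr)\boldsymbol{\lambda}\in\mathbb{R}^M:\boldsymbol{\lambda}\in\mathcal{S}^{M-1}_+\Bigr\}$$ is either a Pareto front surface $$\mathcal{F}^{\mathrm{STR}}_{\boldsymbol{\eta},f,\rho}[X]=\mathcal{Y}^{\mathrm{int}}_{\boldsymbol{\eta}}\Bigl[\bigcup_{\mathbf{x}\in X}\rho\bigl[\mathcal{Y}^{\mathrm{int}}_{\boldsymbol{\eta}}[f(\mathbf{x},\cdot)]\bigr]\Bigr]\in\mathbb{Y}^*_{\boldsymbol{\eta}},$$ or the singleton set $\mathcal{F}^{\mathrm{STR}}_{\boldsymbol{\eta},f,\rho}[X]=\{\boldsymbol{\eta}\}$.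
   Context: $\mathbb{X}\subseteq\mathbb{R}^D$ is the input space and $\Xi\subseteq\mathbb{R}^W$ is the uncertain parameter space. Vectors in $\mathbb{R}^M$ have components $\mathbf{y}=(y^{(1)},\dots,y^{(M)})$. Orderings: $\mathbf{y}\succeq\mathbf{y}'$ iff $\mathbf{y}-\mathbf{y}'\in\mathbb{R}^M_{\ge0}$; $\mathbf{y}\succ\!\succ\mathbf{y}'$ (strong domination) iff $\mathbf{y}-\mathbf{y}'\in\mathbb{R}^M_{>0}$; $\preceq$ and $\prec\!\prec$ are the reverse relations. For a relation $\diamond$ and $A\subseteq\mathbb{R}^M$, $\mathbb{D}_\diamond[A]:=\bigcup_{\mathbf{a}\in A}\{\mathbf{y}\in\mathbb{R}^M:\mathbf{y}\diamond\mathbf{a}\}$. The weak Pareto front $\mathcal{Y}^{\mathrm{weak}}[A]$ is the set of $\mathbf{a}\in A$ such that no $\mathbf{a}'\in A$ satisfies $\mathbf{a}'\succ\!\succ\mathbf{a}$. Pareto front surface: for a bounded set $A\subset\mathbb{R}^M$ and $\boldsymbol{\eta}\in\mathbb{R}^M$, $\mathcal{Y}^{\mathrm{int}}_{\boldsymbol{\eta}}[A]:=\mathcal{Y}^{\mathrm{weak}}[\mathbb{D}_{\preceq}[\mathrm{Closure}(A)]]\cap\mathbb{D}_{\succ\!\succ}[\{\boldsymbol{\eta}\}]$. $\mathbb{Y}^*_{\boldsymbol{\eta}}$ denotes the set of all non-empty Pareto front surfaces with respect to $\boldsymbol{\eta}$, i.e. all non-empty sets of the form $\mathcal{Y}^{\mathrm{int}}_{\boldsymbol{\eta}}[A]$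 with $A$ bounded. $\mathcal{S}^{M-1}_+:=\{\mathbf{y}\in\mathbb{R}^M_{>0}:\|\mathbf{y}\|_{L^2}=1\}$. The length scalarisation function is $s^{\mathrm{Len}}_{(\boldsymbol{\eta},\boldsymbol{\lambda})}(\mathbf{y})=\min_{m=1,\dots,M}\frac{\max(y^{(m)}-\eta^{(m)},0)}{\lambda^{(m)}}$, and $s^{\mathrm{Len}}_{(\boldsymbol{\eta},\boldsymbol{\lambda})}(f(\mathbf{x},\cdot))$ denotes the function $\boldsymbol{\xi}\mapsto s^{\mathrm{Len}}_{(\boldsymbol{\eta},\boldsymbol{\lambda})}(f(\mathbf{x},\boldsymbol{\xi}))$. A univariate risk functional $\rho$ maps any function $h:\Xi\to\mathbb{R}$ to a real number $\rho[h]$. It is partially coherent if: (i) $\rho[0]=0$ for the zero function; (ii) $a(\boldsymbol{\xi})\ge b(\boldsymbol{\xi})$ for all $\boldsymbol{\xi}\in\Xi$ implies $\rho[a]\ge\rho[b]$; (iii) $\rho[\alpha h]=\alpha\rho[h]$ for every scalar $\alpha>0$ and every $h:\Xi\to\mathbb{R}$; (iv) $\rho[h+c]=\rho[h]+c$ for every constant $c\in\mathbb{R}$ and every $h:\Xi\to\mathbb{R}$. The risk statistic of the individual Pareto front surface of an input $\mathbf{x}$ is by definition the set $$\rho\bigl[\mathcal{Y}^{\mathrm{int}}_{\boldsymbol{\eta}}[f(\mathbf{x},\cdot)]\bigr]:=\bigl\{\boldsymbol{\eta}+\rho\bigl[s^{\mathrm{Len}}_{(\boldsymbol{\eta},\boldsymbol{\lambda})}(f(\mathbf{x},\cdot))\bigr]\boldsymbol{\lambda}\in\mathbb{R}^M:\boldsymbol{\lambda}\in\mathcal{S}^{M-1}_+\bigr\}.$$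 *)

(* Defs.v *)
From HB Require Import structures.
From mathcomp Require Import all_boot all_order all_algebra.
From mathcomp Require Import all_classical all_reals all_analysis.

Set Implicit Arguments.
Unset Strict Implicit.
Unset Printing Implicit Defensive.

Import Order.TTheory GRing.Theory Num.Theory.
Import numFieldNormedType.Exports.

Local Open Scope classical_set_scope.
Local Open Scope ring_scope.

(* Vectors of R^M are row vectors 'rV[R]_n.+1 with M = n.+1: only M >= 1 makes
   sense, since the length scalarisation is a minimum over m = 1, ..., M. *)

Definition weak_dominates (R : realType) (n : nat) (y y' : 'rV[R]_n.+1) : Prop :=
  forall m, 0 <= (y - y') 0 m.

Definition strong_dominates (R : realType) (n : nat) (y y' : 'rV[R]_n.+1) : Prop :=
  forall m, 0 < (y - y') 0 m.

Definition weak_dominated (R : realType) (n : nat) (y y' : 'rV[R]_n.+1) : Prop :=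
  weak_dominates y' y.

Definition domination_region (R : realType) (n : nat)
    (rel : 'rV[R]_n.+1 -> 'rV[R]_n.+1 -> Prop) (A : set 'rV[R]_n.+1) :
    set 'rV[R]_n.+1 :=
  \bigcup_(a in A) [set y | rel y a].

Definition weak_pareto_front (R : realType) (n : nat) (A : set 'rV[R]_n.+1) :
    set 'rV[R]_n.+1 :=
  [set a | A a /\ ~ exists2 a', A a' & strong_dominates a' a].

(* Only meant for bounded A. *)
Definition pareto_surface (R : realType) (n : nat) (eta : 'rV[R]_n.+1)
    (A : set 'rV[R]_n.+1) : set 'rV[R]_n.+1 :=
  weak_pareto_front (domination_region (@weak_dominated R n) (closure A))
  `&` domination_region (@strong_dominates R n) [set eta].

Definition pareto_surfaces (R : realType) (n : nat) (eta : 'rV[R]_n.+1) :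
    set (set 'rV[R]_n.+1) :=
  [set S | S !=set0 /\ exists2 A, bounded_set A & S = pareto_surface eta A].

(* The library norm on row vectors is the sup norm; it induces the same closure
   and the same bounded sets, but the sphere needs the Euclidean norm. *)
Definition l2norm (R : realType) (n : nat) (y : 'rV[R]_n.+1) : R :=
  Num.sqrt (\sum_m y 0 m ^+ 2).

Definition positive_sphere (R : realType) (n : nat) : set 'rV[R]_n.+1 :=
  [set y : 'rV[R]_n.+1 | (forall m, 0 < y 0 m) /\ l2norm y = 1].

Definition scal_len_term (R : realType) (n : nat) (eta lambda y : 'rV[R]_n.+1)
    (m : 'I_n.+1) : R :=
  Num.max (y 0 m - eta 0 m) 0 / lambda 0 m.

(* Seeding the iterated minimum with the term of index 0 leaves it unchanged. *)
Definition scal_len (R : realType) (n : nat) (eta lambda y : 'rV[R]_n.+1) : R :=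
  \big[Num.min/scal_len_term eta lambda y ord0]_(m < n.+1)
    scal_len_term eta lambda y m.

Record partially_coherent (R : realType) (T : Type) (rho : (T -> R) -> R) :
    Prop := PartiallyCoherent {
  pcoh_zero : rho (fun _ => 0) = 0 ;
  pcoh_mono : forall a b : T -> R, (forall t, b t <= a t) -> rho b <= rho a ;
  pcoh_homo : forall (alpha : R) (h : T -> R), 0 < alpha ->
    rho (fun t => alpha * h t) = alpha * rho h ;
  pcoh_trans : forall (h : T -> R) (c : R), rho (fun t => h t + c) = rho h + c
}.

Definition risk_surface (R : realType) (n : nat) (I T : Type)
    (eta : 'rV[R]_n.+1) (f : I * T -> 'rV[R]_n.+1) (rho : (T -> R) -> R)
    (x : I) : set 'rV[R]_n.+1 :=
  [set eta + rho (fun xi => scal_len eta lambda (f (x, xi))) *: lambda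
    | lambda in @positive_sphere R n].

(* With the library convention sup set0 = 0, the front of the empty set of
   inputs is [set eta]. *)
Definition str_front (R : realType) (n : nat) (I T : Type)
    (eta : 'rV[R]_n.+1) (f : I * T -> 'rV[R]_n.+1) (rho : (T -> R) -> R)
    (X : set I) : set 'rV[R]_n.+1 :=
  [set eta + sup [set rho (fun xi => scal_len eta lambda (f (x, xi)))
                   | x in X] *: lambda
    | lambda in @positive_sphere R n].

(* Main.v *)
(* For positive v put g v = sup_(x in X) rho [s^Len_(eta, v) (f (x, .))]. Partial
   coherence makes g antitone and homogeneous of degree -1, so either g vanishes
   at every positive vector and the front is {eta}, or g is positive at all of
   them and the front is {eta + v : v > 0, g v = 1}. In the latter case, for
   v > 0, the point eta + v is weakly dominated by the closure of the union of
   the individual risk surfaces iff 1 <= g v; hence the front is the weak Pareto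
   front of that region. *)

Require Import Defs.
From mathcomp Require Import all_boot all_order all_algebra.
From mathcomp Require Import all_classical all_reals all_analysis.
From mathcomp Require Import lra.

Import Order.TTheory GRing.Theory Num.Theory.
Import numFieldNormedType.Exports.

Local Open Scope classical_set_scope.
Local Open Scope ring_scope.

Set Implicit Arguments.
Unset Strict Implicit.

(** * Positive vectors, norms and the length scalarisation *)

Definition positive_vector (R : realType) (n : nat) (v : 'rV[R]_n.+1) : Prop :=
  forall m, 0 < v 0 m.

Section PositiveVectors.
Variables (R : realType) (n : nat).
Implicit Types (u v w lambda : 'rV[R]_n.+1) (a c : R).

Lemma positive_vectorZ c v :
  0 < c -> positive_vector v -> positive_vector (c *: v).
Proof. by move=> c0 v0 m; rewrite mxE mulr_gt0. Qed.

(* Used with a = 0 to compare positive vectors up to scaling, and with a = 1 to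
   turn strong domination into domination by a factor c > 1. *)
Lemma coord_ratio_gap a v w : positive_vector v ->
  (forall m, a * v 0 m < w 0 m) ->
  exists2 c, a < c & forall m, c * v 0 m <= w 0 m.
Proof.
move=> v0 avw; exists (\big[Num.min/a + 1]_m (w 0 m / v 0 m)).
  by apply: lt_bigmin => [|m _]; [rewrite ltrDl|rewrite ltr_pdivlMr].
by move=> m; rewrite -ler_pdivlMr//; exact: bigmin_le.
Qed.

Lemma l2norm_gt0 v : positive_vector v -> 0 < l2norm v.
Proof.
move=> v0; rewrite sqrtr_gt0 (bigD1 ord0)//= ltr_pwDl ?exprn_gt0//.
by apply: sumr_ge0 => m _; exact: sqr_ge0.
Qed.

Lemma l2normZ c v : 0 <= c -> l2norm (c *: v) = c * l2norm v.
Proof.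
move=> c0; rewrite /l2norm.
under eq_bigr do rewrite mxE exprMn.
by rewrite -mulr_sumr sqrtrM ?sqr_ge0// sqrtr_sqr ger0_norm.
Qed.

Lemma normalised_positive_sphere v : positive_vector v ->
  positive_sphere ((l2norm v)^-1 *: v).
Proof.
move=> v0; have l0 := l2norm_gt0 v0; split.
  by apply: positive_vectorZ => //; rewrite invr_gt0.
by rewrite l2normZ ?invr_ge0 ?ltW// mulVf// gt_eqF.
Qed.

Lemma positive_sphere_nonempty : @positive_sphere R n !=set0.
Proof.
exists ((l2norm (const_mx 1 : 'rV[R]_n.+1))^-1 *: const_mx 1).
by apply: normalised_positive_sphere => m; rewrite mxE.
Qed.

Lemma row_norm_coord v m : `|v 0 m| <= `|v|.
Proof. by rewrite [leRHS]/Num.Def.normr /= mx_normrE; apply/bigmax_geP; right; exists (0, m). Qed.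

Lemma row_norm_le v (B : R) : 0 <= B -> (forall m, `|v 0 m| <= B) -> `|v| <= B.
Proof.
move=> B0 vB; rewrite [leLHS]/Num.Def.normr /= mx_normrE; apply/bigmax_leP.
by split=> // -[i m] _ /=; rewrite ord1.
Qed.

Lemma closure_normP (A : set 'rV[R]_n.+1) p :
  closure A p <-> forall e, 0 < e -> exists2 q, A q & `|p - q| < e.
Proof.
split=> [Ap e e0|Ap U /nbhs_ballP[e /= e0 eU]].
  have [q [Aq]] := Ap _ (nbhsx_ballx p e e0).
  by rewrite mx_norm_ball => pq; exists q.
have [q Aq pq] := Ap e e0; exists q; split => //.
by apply: eU; rewrite mx_norm_ball.
Qed.

(** The numerators of the terms are nonnegative, so the hypothesis only has to compare denominators.
    A risk functional preserves this pointwise inequality by monotonicity and positive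
    homogeneity. *)
Lemma scal_len_scale (eta u v y : 'rV[R]_n.+1) c :
  0 < c -> positive_vector u -> positive_vector v ->
  (forall m, c * u 0 m <= v 0 m) ->
  c * scal_len eta v y <= scal_len eta u y.
Proof.
move=> c0 u0 v0 cuv.
have H m : c * scal_len eta v y <= scal_len_term eta u y m.
  rewrite (@le_trans _ _ (c * scal_len_term eta v y m))//.
    by rewrite ler_pM2l//; exact: bigmin_le.
  rewrite /scal_len_term mulrCA ler_wpM2l ?le_max ?lexx ?orbT//.
  by rewrite -ler_pdivlMl// -invfM lef_pV2 ?posrE ?mulr_gt0// mulrC.
by apply/bigmin_geP.
Qed.

Lemma scal_len_ge0 (eta v y : 'rV[R]_n.+1) :
  positive_vector v -> 0 <= scal_len eta v y.
Proof.
move=> v0.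
have H m : 0 <= scal_len_term eta v y m.
  by rewrite divr_ge0 ?le_max ?lexx ?orbT// ltW.
by apply/bigmin_geP.
Qed.

Lemma scal_len_le (eta v y : 'rV[R]_n.+1) m (B : R) :
  positive_vector v -> `|y - eta| <= B -> scal_len eta v y <= B / v 0 m.
Proof.
move=> v0 yB; rewrite (@le_trans _ _ (scal_len_term eta v y m))//.
  exact: bigmin_le.
rewrite /scal_len_term ler_pM2r ?invr_gt0// ge_max.
rewrite (le_trans (normr_ge0 _) yB) andbT (le_trans (ler_norm _))//.
by rewrite (le_trans _ yB)//; have := row_norm_coord (y - eta) m; rewrite !mxE.
Qed.

End PositiveVectors.

(* [polar_scale] expresses at once that [r i] is antitone and homogeneous of
   degree -1; [B] bounds the coordinates of the points [r i v *: v]. *)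
Record polar_family (R : realType) (n : nat) (I : Type)
    (r : I -> 'rV[R]_n.+1 -> R) (B : R) : Prop := PolarFamily {
  polar_ge0 : forall i v, positive_vector v -> 0 <= r i v ;
  polar_scale : forall i c u v, 0 < c -> positive_vector u ->
    positive_vector v -> (forall m, c * u 0 m <= v 0 m) ->
    c * r i v <= r i u ;
  polar_le : forall i v m, positive_vector v -> r i v * v 0 m <= B }.

(** A surface in polar coordinates centred at [eta], with [g] as radius. Both [str_front] and each
    [risk_surface] have this form by conversion. *)
Definition polar_set (R : realType) (n : nat) (eta : 'rV[R]_n.+1)
    (g : 'rV[R]_n.+1 -> R) : set 'rV[R]_n.+1 :=
  [set eta + g lambda *: lambda | lambda in @positive_sphere R n].

Definition polar_sup (R : realType) (n : nat) (I : Type) (X : set I)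
    (r : I -> 'rV[R]_n.+1 -> R) (v : 'rV[R]_n.+1) : R :=
  sup [set r x v | x in X].

(** * The front traced by the supremum of a polar family *)

Section PolarFamilies.
Variables (R : realType) (n : nat) (I : Type) (X : set I).
Variables (r : I -> 'rV[R]_n.+1 -> R) (B : R) (eta : 'rV[R]_n.+1).
Hypotheses (r_polar : polar_family r B) (X0 : X !=set0).
Implicit Types (u v w lambda : 'rV[R]_n.+1) (c : R).
Local Notation g := (polar_sup X r).

Lemma polar_has_sup v : positive_vector v -> has_sup [set r x v | x in X].
Proof.
move=> v0; split; first by have [x Xx] := X0; exists (r x v), x.
exists (B / v 0 0) => _ [x _ <-].
by rewrite ler_pdivlMr//; exact: (polar_le r_polar).
Qed.

Lemma le_polar_sup x v : positive_vector v -> X x -> r x v <= g v.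
Proof. by move=> v0 Xx; apply: ub_le_sup; [case: (polar_has_sup v0)|exists x]. Qed.

Lemma polar_sup_le v c : positive_vector v ->
  (forall x, X x -> r x v <= c) -> g v <= c.
Proof.
move=> v0 H; apply: ge_sup; first by case: (polar_has_sup v0).
by move=> _ [x Xx <-]; exact: H.
Qed.

Lemma polar_sup_ge0 v : positive_vector v -> 0 <= g v.
Proof.
move=> v0; have [x Xx] := X0.
by rewrite (le_trans (polar_ge0 r_polar x v0))// le_polar_sup.
Qed.

Lemma polar_sup_scale c u v : 0 < c -> positive_vector u -> positive_vector v ->
  (forall m, c * u 0 m <= v 0 m) -> c * g v <= g u.
Proof.
move=> c0 u0 v0 cuv; rewrite -ler_pdivlMl//; apply: polar_sup_le => // x Xx.
rewrite ler_pdivlMl// (le_trans _ (le_polar_sup u0 Xx))//.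
exact: (polar_scale r_polar).
Qed.

Lemma polar_supZ c v : 0 < c -> positive_vector v -> c * g (c *: v) = g v.
Proof.
move=> c0 v0; have cv0 := positive_vectorZ c0 v0.
apply/eqP; rewrite eq_le; apply/andP; split.
  by apply: polar_sup_scale => // m; rewrite mxE.
rewrite -ler_pdivrMl//; apply: polar_sup_scale => // [|m].
  by rewrite invr_gt0.
by rewrite mxE mulKf// gt_eqF.
Qed.

(** Any two positive vectors are comparable up to a positive factor; this yields the dichotomy of
    the theorem. *)
Lemma polar_sup_gt0 u v : positive_vector u -> positive_vector v ->
  0 < g u -> 0 < g v.
Proof.
move=> u0 v0 gu.
have [|c c0 cvu] := @coord_ratio_gap R n 0 v u v0.
  by move=> m; rewrite mul0r.
by rewrite (lt_le_trans _ (polar_sup_scale c0 v0 u0 cvu))// mulr_gt0.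
Qed.

Local Notation A := (\bigcup_(x in X) polar_set eta (r x)).
Local Notation D := (domination_region (@weak_dominated R n) (closure A)).

Lemma polar_set_bounded x p : polar_set eta (r x) p -> `|p - eta| <= B.
Proof.
move=> [l [l0 _] <-]; rewrite addrAC subrr add0r.
have rl := polar_ge0 r_polar x l0.
have lB m := polar_le r_polar x m l0.
apply: row_norm_le => [|m].
  by rewrite (le_trans _ (lB 0))// mulr_ge0// ltW.
by rewrite mxE ger0_norm ?mulr_ge0// ltW.
Qed.

Lemma bounded_polar_sets : bounded_set A.
Proof.
exists (B + `|eta|); split; first exact: num_real.
move=> M BM p [x Xx /polar_set_bounded pB].
rewrite /= -[p](subrK eta) (le_trans (ler_normD _ _))// (le_trans _ (ltW BM))//.
by rewrite lerD2r.
Qed.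

(** The supremum need not be attained, so the point is only a limit of points of the individual
    surfaces. By homogeneity it depends only on the direction of [v], which may thus be
    normalised. *)
Lemma polar_sup_boundary v : positive_vector v ->
  closure A (eta + g v *: v).
Proof.
move=> v0; have l0 := l2norm_gt0 v0.
pose l := (l2norm v)^-1 *: v.
have vE : v = l2norm v *: l by rewrite scalerA mulfV ?scale1r// gt_eqF.
have [lpos _] : positive_sphere l by exact: normalised_positive_sphere.
have -> : g v *: v = g l *: l.
  by rewrite [v in _ *: v]vE scalerA mulrC {2}vE polar_supZ.
apply/closure_normP => e e0.
(* The summand 1 keeps the denominator positive. *)
have d0 : 0 < e / (`|l| + 1).
  by rewrite divr_gt0// ltr_wpDl.
have [_ [x Xx <-] glt] := sup_adherent d0 (polar_has_sup lpos).
exists (eta + r x l *: l).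
  by exists x => //; exists l => //; exact: normalised_positive_sphere.
rewrite opprD addrACA subrr add0r -scalerBl normrZ.
rewrite ger0_norm ?subr_ge0 ?le_polar_sup//.
have : g l - r x l < e / (`|l| + 1) by rewrite ltrBlDr -ltrBlDl.
rewrite ltr_pdivlMr ?ltr_wpDl// => h; apply: le_lt_trans h.
by rewrite ler_wpM2l ?subr_ge0 ?le_polar_sup// lerDl.
Qed.

Lemma domination_polarP v : positive_vector v -> D (eta + v) <-> 1 <= g v.
Proof.
move=> v0; split => [[p /closure_normP Ap vp]|gv]; last first.
  exists (eta + g v *: v); first exact: polar_sup_boundary.
  move=> m; rewrite !mxE opprD addrACA subrr add0r subr_ge0.
  by rewrite ler_peMl// ltW.
(* It suffices to show [1 - e <= g v]; only [e < 1] is of interest. *)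
apply/ler_addgt0Pr => e e0; rewrite -lerBlDr.
have [e1|e1] := lerP 1 e.
  by rewrite (le_trans _ (polar_sup_ge0 v0))// subr_le0.
(* Here [d] is a positive lower bound for the coordinates of [v]. Moving by less than [d * e] from
   [p] then costs each coordinate at most the fraction [e] of that of [v]. *)
have [||d d0 dv] := @coord_ratio_gap R n 0 (const_mx e) (e *: v).
- by move=> m; rewrite mxE.
- by move=> m; rewrite !mxE mul0r mulr_gt0.
have [_ [x Xx [l [lpos lnorm] <-]] pq] := Ap (d * e) (mulr_gt0 d0 e0).
have le1 m : (1 - e) * v 0 m <= r x l * l 0 m.
  have := row_norm_coord (p - (eta + r x l *: l)) m.
  move=> /le_lt_trans/(_ pq)/ltr_normlW.
  have := vp m; have := dv m; rewrite !mxE; nra.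
have rl : 0 < r x l.
  have := le1 0; have : 0 < (1 - e) * v 0 0 by rewrite mulr_gt0// subr_gt0.
  by move=> /lt_le_trans h /h; rewrite pmulr_lgt0.
have rV : 0 < (1 - e) / r x l by rewrite divr_gt0// subr_gt0.
rewrite (le_trans _ (le_polar_sup v0 Xx))//.
(* This factor scales [v] below the unit direction [l], so [polar_scale] transfers the bound from
   [l] to [v]. *)
have -> : 1 - e = (1 - e) / r x l * r x l by rewrite divfK// gt_eqF.
apply: (polar_scale r_polar) => // m.
by rewrite mulrAC ler_pdivrMr// [leRHS]mulrC.
Qed.

Lemma domination_polarE p : positive_vector (p - eta) -> D p <-> 1 <= g (p - eta).
Proof. by move=> /domination_polarP; rewrite addrC subrK. Qed.

Lemma pareto_surface_polar : pareto_surface eta A =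
  [set p | positive_vector (p - eta) /\ g (p - eta) = 1].
Proof.
rewrite eqEsubset; split => p.
  move=> [[Dp maxp] [_ -> p0]]; split => //.
  have gp := (domination_polarE p0).1 Dp.
  apply/eqP; rewrite eq_le gp andbT leNgt; apply/negP => g1.
  apply: maxp; have g0 := lt_trans ltr01 g1.
  (* If [g (p - eta) > 1], pushing [p] radially outwards by this factor reaches level 1: the point
     stays in the region yet strongly dominates [p]. *)
  exists (eta + g (p - eta) *: (p - eta)).
    apply/domination_polarP; first exact: positive_vectorZ.
    by rewrite -(ler_pM2l g0) mulr1 polar_supZ.
  move=> m; have := p0 m; rewrite !mxE; nra.
move=> [p0 gp]; split; last by exists eta.
split; first by apply/domination_polarE; rewrite ?gp.
move=> [q Dq qp].
have q0 : positive_vector (q - eta).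
  by move=> m; have := p0 m; have := qp m; rewrite !mxE; lra.
have gq := (domination_polarE q0).1 Dq.
have [|c c1 cpq] := @coord_ratio_gap R n 1 (p - eta) (q - eta) p0.
  by move=> m; have := qp m; rewrite !mxE; lra.
(* This gives [c * g (q - eta) <= 1] with [c > 1], against [1 <= g (q - eta)]. *)
have := polar_sup_scale (lt_trans ltr01 c1) p0 q0 cpq.
by rewrite gp; nra.
Qed.

Lemma polar_set_supE : (exists2 u, positive_vector u & 0 < g u) ->
  polar_set eta g = [set p | positive_vector (p - eta) /\ g (p - eta) = 1].
Proof.
move=> [u u0 gu]; rewrite eqEsubset; split => p.
  move=> [l [l0 _] <-]; rewrite /= addrAC subrr add0r.
  have gl := polar_sup_gt0 u0 l0 gu.
  split; first exact: positive_vectorZ.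
  by apply: (mulfI (lt0r_neq0 gl)); rewrite mulr1 polar_supZ.
move=> [p0 gp]; have l0 := l2norm_gt0 p0.
exists ((l2norm (p - eta))^-1 *: (p - eta)).
  exact: normalised_positive_sphere.
(* Homogeneity and [g (p - eta) = 1] make the radius in this direction equal to
   [l2norm (p - eta)]. *)
have := @polar_supZ (l2norm (p - eta))^-1 (p - eta).
rewrite invr_gt0 gp => /(_ l0 p0) h.
by rewrite scalerA mulrC h scale1r addrC subrK.
Qed.

End PolarFamilies.

(** * The degenerate front, and risk functionals as polar families *)

Lemma polar_set0 (R : realType) (n : nat) (eta : 'rV[R]_n.+1)
    (g : 'rV[R]_n.+1 -> R) :
  (forall v, positive_vector v -> g v = 0) -> polar_set eta g = [set eta].
Proof.
move=> g0; rewrite eqEsubset; split => [_ [l [l0 _] <-]|_ ->].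
  by rewrite g0// scale0r addr0.
have [l l1] := positive_sphere_nonempty R n; exists l => //.
by case: l1 => l0 _; rewrite g0// scale0r addr0.
Qed.

Lemma risk_const (R : realType) (T : Type) (rho : (T -> R) -> R) (c : R) :
  partially_coherent rho -> rho (fun=> c) = c.
Proof.
move=> rhoP; have := pcoh_trans rhoP (fun=> 0) c.
by rewrite pcoh_zero// !add0r.
Qed.

(** Comparison with the zero function gives nonnegativity, and comparison with a constant, which
    [rho] fixes, gives the bound. *)
Lemma risk_polar_family (R : realType) (n : nat) (I T : Type)
    (f : I * T -> 'rV[R]_n.+1) (eta : 'rV[R]_n.+1) (rho : (T -> R) -> R) (B : R) :
  partially_coherent rho -> (forall z, `|f z - eta| <= B) ->
  polar_family
    (fun x lambda => rho (fun xi => scal_len eta lambda (f (x, xi)))) B.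
Proof.
move=> rhoP fB; split => [x v v0|x c u v c0 u0 v0 cuv|x v m v0].
- rewrite -[leLHS](pcoh_zero rhoP); apply: (pcoh_mono rhoP) => xi.
  exact: scal_len_ge0.
- rewrite -(pcoh_homo rhoP) //; apply: (pcoh_mono rhoP) => xi.
  exact: scal_len_scale.
- rewrite -ler_pdivlMr// -[leRHS](@risk_const R T rho)//.
  by apply: (pcoh_mono rhoP) => xi; exact: scal_len_le.
Qed.

Unset Implicit Arguments.

Theorem proposition4p3 (R : realType) (D W n : nat)
    (XX : set 'rV[R]_D) (Xi : set 'rV[R]_W)
    (f : XX * Xi -> 'rV[R]_n.+1) (f_bounded : bounded_fun f)
    (eta : 'rV[R]_n.+1)
    (rho : (Xi -> R) -> R) (rho_coherent : partially_coherent rho)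
    (X : set XX) :
  (str_front eta f rho X
     = pareto_surface eta (\bigcup_(x in X) risk_surface eta f rho x)
   /\ pareto_surfaces eta (str_front eta f rho X))
  \/ str_front eta f rho X = [set eta].
Proof.
have [M [_ fM]] := f_bounded.
(* Boundedness provides a bound only for reals strictly above [M]. *)
pose C := M + 1.
have fC z : `|f z| <= C by apply: (fM C) => //; rewrite ltrDl.
have fB z : `|f z - eta| <= C + `|eta|.
  by rewrite (le_trans (ler_normB _ _))// lerD2r.
have rP := risk_polar_family rho_coherent fB.
set r := (fun x : XX => _) in rP.
have -> : str_front eta f rho X = polar_set eta (polar_sup X r) by [].
have -> : \bigcup_(x in X) risk_surface eta f rho x
  = \bigcup_(x in X) polar_set eta (r x) by [].
have [->|/set0P X0] := eqVneq X set0.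
  by right; apply: polar_set0 => v _; rewrite /polar_sup image_set0 sup0.
have [gpos|gnpos] :=
  pselect (exists2 u, positive_vector u & 0 < polar_sup X r u).
  have surfaceE : polar_set eta (polar_sup X r)
      = pareto_surface eta (\bigcup_(x in X) polar_set eta (r x)).
    rewrite (polar_set_supE _ rP)//.
    by rewrite (pareto_surface_polar _ rP).
  left; split => //; split.
    have [l l1] := positive_sphere_nonempty R n.
    by eexists; exists l.
  by exists (\bigcup_(x in X) polar_set eta (r x)); first exact: (bounded_polar_sets _ _ rP).
right; apply: polar_set0 => v v0; apply/eqP; rewrite eq_le.
rewrite (polar_sup_ge0 rP)// andbT leNgt.
by apply/negP => gv; apply: gnpos; exists v.
Qed.
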